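(* Let $(\mathcal{A},\phi)$ and $(\mathcal{B},\psi)$ be measured C*-algebras. (i) If $(T_k)_{k\in\mathbb{N}}$ is a sequence in $(\mathcal{A}\otimes\mathcal{B})_+$, $T\in(\mathcal{A}\otimes\mathcal{B})_+$ and $T_k\to_{k\to\infty}T$ in the weak* topology, then $\alpha(T)\leq\liminf_{k\to\infty}\alpha(T_k)$. If, in addition, the sequence $(T_k)_{k\in\mathbb{N}}$ is monotone, then $\alpha(T)=\lim_{k\to\infty}\alpha(T_k)$. (ii) The function $\alpha:(\mathcal{A}\otimes\mathcal{B})_+\to\mathbb{R}^+$ is convex, monotone and continuous in the norm topology.
   Context: All C*-algebras are unital. A measured C*-algebra is a pair $(\mathcal{A},\phi)$ of a unital C*-algebra $\mathcal{A}$ and a state $\phi$ on it. $\mathcal{A}\otimes\mathcal{B}$ is the minimal C*-tensor product, viewed inside its second dual $(\mathcal{A}\otimes\mathcal{B})^{**}$; the weak* topology is that of $(\mathcal{A}\otimes\mathcal{B})^{**}$. $\mathbb{R}^+=[0,\infty)$. A coupling of $\phi$ and $\psi$ is a positive functional $\sigma:\mathcal{A}\otimes\mathcal{B}\to\mathbb{C}$ with $\sigma(a\otimes 1)=\phi(a)$ for all $a\in\mathcal{A}$ and $\sigma(1\otimes b)=\psi(b)$ for all $b\in\mathcal{B}$; $\mathsf{C}(\phi,\psi)$ is the set of all couplings. For a positive element $T$, $\alpha(T)=\sup\{\sigma(T):\sigma\in\mathsf{C}(\phi,\psi)\}$. *)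

(* Defs.v *)
From HB Require Import structures.
From mathcomp Require Import all_boot all_order all_algebra.
From mathcomp Require Import sesquilinear complex.
From mathcomp Require Import all_classical all_reals all_analysis.

Set Implicit Arguments.
Unset Strict Implicit.
Unset Printing Implicit Defensive.

Import Order.TTheory GRing.Theory Num.Theory.
Import numFieldNormedType.Exports.

Local Open Scope classical_set_scope.
Local Open Scope ring_scope.

(* The product is a field of the mixin instead of being inherited from
   GRing.Algebra because Hierarchy Builder cannot join ring structures with
   normed modules above NumDomain. *)
HB.mixin Record isCStarAlgebra (R : realType) A
    of CompleteNormedModule R[i] A := {
  cone : A ;
  cmul : A -> A -> A ;
  star : A -> A ;
  cmulA : associative cmul ;
  cmul1x : left_id cone cmul ;
  cmulx1 : right_id cone cmul ;
  cmulDl : left_distributive cmul +%R ;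
  cmulDr : right_distributive cmul +%R ;
  cmulZl : forall (c : R[i]) x y, cmul (c *: x) y = c *: cmul x y ;
  cmulZr : forall (c : R[i]) x y, cmul x (c *: y) = c *: cmul x y ;
  starK : involutive star ;
  starD : {morph star : x y / x + y} ;
  starZ : forall (c : R[i]) x, star (c *: x) = c^* *: star x ;
  starM : forall x y, star (cmul x y) = cmul (star y) (star x) ;
  cnormM : forall x y, `|cmul x y| <= `|x| * `|y| ;
  cnorm_star : forall x, `|cmul (star x) x| = `|x| ^+ 2 }.

#[short(type="cstarAlgType")]
HB.structure Definition CStarAlgebra (R : realType) :=
  {A of CompleteNormedModule R[i] A & isCStarAlgebra R A}.

Notation "x ** y" := (cmul x y) (at level 40, left associativity) : ring_scope.

Arguments cone {R s}.

(* [inner] is linear in its first argument, conjugate-linear in the second. *)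
HB.mixin Record isHilbert (R : realType) H
    of CompleteNormedModule R[i] H := {
  inner : {dot H for (@Num.conj R[i])} ;
  normE_inner : forall x : H, `|x| ^+ 2 = inner x x }.

#[short(type="hilbertType")]
HB.structure Definition Hilbert (R : realType) :=
  {H of CompleteNormedModule R[i] H & isHilbert R H}.

Section Dual.
Variable R : realType.

Definition opnorm (V W : normedModType R[i]) (f : V -> W) : R :=
  sup [set complex.Re `|f x| | x in [set x : V | `|x| <= 1]].

Lemma opnorm_ub (V W : normedModType R[i]) (f : V -> W) : linear f ->
  continuous f -> has_ubound [set complex.Re `|f x| | x in [set x : V | `|x| <= 1]].
Proof.
move=> lf cf.
pose g : {linear V -> W} := HB.pack f (GRing.isLinear.Build _ _ _ _ _ lf).
have /linear_bounded_continuous/linear_boundedP : continuous g by [].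
case/pinfty_ex_gt0 => M M0 gM; exists (complex.Re M) => _ [x /= x1 <-].
have : `|f x| <= M.
  by rewrite (le_trans (gM x))// ler_piMr// ltW.
by rewrite lecE => /andP[].
Qed.

Lemma opnormP (V W : normedModType R[i]) (f : V -> W) : linear f ->
  continuous f -> forall x, `|f x| <= (opnorm f)%:C%C * `|x|.
Proof.
move=> lf cf x.
pose g : {linear V -> W} := HB.pack f (GRing.isLinear.Build _ _ _ _ _ lf).
have realC (W' : normedModType R[i]) (y : W') :
    `|y| = (complex.Re `|y|)%:C%C by rewrite RRe_real// ger0_real.
have [->|x0] := eqVneq x 0.
  by rewrite (linear0 g : f 0 = 0) !normr0 mulr0.
have nx : 0 < `|x| by rewrite normr_gt0.
rewrite -ler_pdivrMr//.
have -> : `|f x| / `|x| = `|f (`|x|^-1 *: x)|.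
  have -> : f (`|x|^-1 *: x) = `|x|^-1 *: f x := linearZ_LR g _ _.
  by rewrite normrZ normfV normr_id mulrC.
rewrite (realC W) lecR; apply: ub_le_sup; first exact: opnorm_ub.
exists (`|x|^-1 *: x) => //=.
by rewrite normrZ normfV normr_id mulVf// gt_eqF.
Qed.

Lemma opnorm_le (V W : normedModType R[i]) (f : V -> W) (M : R) :
  (forall x, `|x| <= 1 -> `|f x| <= M%:C%C) -> opnorm f <= M.
Proof.
move=> fM; apply: ge_sup.
  by exists (complex.Re `|f 0|), 0 => //=; rewrite normr0.
by move=> _ [x /= /fM + <-]; rewrite lecE => /andP[].
Qed.

Lemma opnorm_ge0 (V W : normedModType R[i]) (f : V -> W) : linear f ->
  continuous f -> 0 <= opnorm f.
Proof.
move=> lf cf; have: (0 <= complex.Re `|f 0|).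
  by have := normr_ge0 (f 0); rewrite lecE => /andP[].
move=> /le_trans; apply; apply: ub_le_sup; first exact: opnorm_ub.
by exists 0 => //=; rewrite normr0.
Qed.

Variable V : normedModType R[i].

Definition dual_pred : {pred (V -> R[i]^o)} :=
  fun f : V -> R[i]^o => `[< linear f /\ continuous f >].

Lemma dual_predP : submod_closed dual_pred.
Proof.
split=> [|c f g].
  by apply/asboolP; split=> [? ? ?|x]; rewrite ?scaler0 ?addr0//; exact: cvg_cst.
move=> /asboolP[lf cf] /asboolP[lg cg]; apply/asboolP; split.
  move=> a x y; rewrite /= !fctE /= lf lg.
  by rewrite !scalerDr !scalerA [c * a]mulrC -!addrA; congr +%R; rewrite addrCA.
by move=> x; apply: cvgD; [apply: cvgZr; exact: cf|exact: cg].
Qed.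

HB.instance Definition _ := GRing.isSubmodClosed.Build _ _ dual_pred dual_predP.

Record dual := Dual { dual_fun :> V -> R[i]^o ; dualP : dual_fun \in dual_pred }.

HB.instance Definition _ := [isSub for dual_fun].
HB.instance Definition _ := gen_eqMixin dual.
HB.instance Definition _ := gen_choiceMixin dual.
HB.instance Definition _ := [SubChoice_isSubLmodule of dual by <:].

Lemma dual_linear (f : dual) : linear f.
Proof. by have /asboolP[] := dualP f. Qed.

Lemma dual_continuous (f : dual) : continuous f.
Proof. by have /asboolP[] := dualP f. Qed.

Definition dual_norm (f : dual) : R[i] := (opnorm f)%:C%C.

Lemma dual_normP (f : dual) x : `|f x| <= dual_norm f * `|x|.
Proof. exact: opnormP (dual_linear f) (@dual_continuous f) x. Qed.

Lemma dual_norm_le (f : dual) (M : R[i]) : 0 <= M ->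
  (forall x, `|f x| <= M * `|x|) -> dual_norm f <= M.
Proof.
move=> M0 fM; rewrite -[M]RRe_real ?ger0_real// lecR; apply: opnorm_le => x x1.
by rewrite RRe_real ?ger0_real// (le_trans (fM x))// ler_piMr.
Qed.

Lemma dual_norm_ge0 (f : dual) : 0 <= dual_norm f.
Proof.
by rewrite ler0c; exact: opnorm_ge0 (dual_linear f) (@dual_continuous f).
Qed.

Lemma dual_normD (f g : dual) : dual_norm (f + g) <= dual_norm f + dual_norm g.
Proof.
apply: dual_norm_le => [|x]; first by rewrite addr_ge0// dual_norm_ge0.
by rewrite mulrDl (le_trans (ler_normD _ _))// lerD// dual_normP.
Qed.

Lemma dual_normZ (c : R[i]) (f : dual) : dual_norm (c *: f) = `|c| * dual_norm f.
Proof.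
have leZ a h : dual_norm (a *: h) <= `|a| * dual_norm h.
  apply: dual_norm_le => [|x]; first by rewrite mulr_ge0// dual_norm_ge0.
  by rewrite /= normrZ -mulrA ler_wpM2l// dual_normP.
apply/eqP; rewrite eq_le leZ /=.
have [->|c0] := eqVneq c 0; first by rewrite normr0 mul0r dual_norm_ge0.
rewrite -ler_pdivlMl ?normr_gt0// -normfV.
by rewrite -[in X in X <= _](scale1r f) -(mulVf c0) -scalerA leZ.
Qed.

Lemma dual_norm_eq0 (f : dual) : dual_norm f = 0 -> f = 0.
Proof.
move=> f0; apply/val_inj/funext => x /=; apply/eqP; rewrite -normr_le0.
by have := dual_normP f x; rewrite f0 mul0r.
Qed.

HB.instance Definition _ := @Lmodule_isNormed.Build R[i] dual
  dual_norm dual_normD dual_normZ dual_norm_eq0.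

End Dual.

Section WeakStar.
Variables (R : realType) (V : normedModType R[i]).

Definition weakstar : Type :=
  initial_topology (fun f : dual V => (f : {ptws V -> R[i]^o})).

HB.instance Definition _ := Uniform.on weakstar.

Lemma evalP (x : V) : (fun f : dual V => f x) \in @dual_pred R (dual V).
Proof.
apply/asboolP; have lx : linear (fun f : dual V => f x : R[i]^o) by [].
split=> //.
pose g : {linear dual V -> R[i]^o} :=
  HB.pack (fun f : dual V => f x : R[i]^o) (GRing.isLinear.Build _ _ _ _ _ lx).
apply: (@bounded_linear_continuous _ _ _ g); apply/linear_boundedP.
near=> r => f; rewrite mulrC (le_trans (dual_normP f x))//.
by rewrite ler_wpM2l ?dual_norm_ge0//; near: r; apply: nbhs_pinfty_ge.
Unshelve. all: by end_near. Qed.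

End WeakStar.

(* the canonical embedding of V into its second dual *)
Definition bidual (R : realType) (V : normedModType R[i]) (x : V) :
  weakstar (dual V) := Dual (evalP x).

Lemma bidual_cvgP (R : realType) (V : normedModType R[i])
    (x_ : nat -> V) (x : V) :
  (bidual (x_ k) @[k --> \oo] --> bidual x) <->
  (forall f : dual V, f (x_ k) @[k --> \oo] --> (f x : R[i]^o)).
Proof.
pose e := fun F : dual (dual V) => (F : {ptws dual V -> R[i]^o}).
split=> [cx f|cx].
  have : e (bidual (x_ k)) @[k --> \oo] --> e (bidual x).
    exact: (cvg_comp _ _ cx (@initial_continuous _ _ e (bidual x))).
  by move=> /pointwise_cvgP/(_ f).
have ex : e (bidual (x_ k)) @[k --> \oo] --> e (bidual x).
  by apply/pointwise_cvgP => f; exact: cx.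
move=> U; rewrite nbhsE => -[W [[B oB <-] Bx] BU].
have : \forall k \near \oo, B (e (bidual (x_ k))).
  by apply: ex; exact: open_nbhs_nbhs.
by apply: filterS => k Bk; exact: BU.
Qed.

Section Representations.
Variable R : realType.

Definition lspan (V : lmodType R[i]) (S : set V) : set V :=
  [set v | exists n (c : 'I_n -> R[i]) (x : 'I_n -> V),
     (forall i, S (x i)) /\ v = \sum_(i < n) c i *: x i].

(* unital *-representations on H by bounded operators *)
Definition representation (A : cstarAlgType R) (H : hilbertType R)
    (pi : A -> H -> H) :=
  [/\ forall a, linear (pi a) /\ continuous (pi a),
      forall h, linear (pi ^~ h),
      pi cone = id,
      forall a b, pi (a ** b) = pi a \o pi b &
      forall a h k, inner (pi (star a) h) k = inner h (pi a k)].

Definition faithful_representation (A : cstarAlgType R) (H : hilbertType R)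
  (pi : A -> H -> H) := representation pi /\ injective pi.

Definition hilbert_tensor (H K L : hilbertType R) (t : H -> K -> L) :=
  [/\ (forall k, linear (t ^~ k)) /\ (forall h, linear (t h)),
      forall h h' k k', inner (t h k) (t h' k') = inner h h' * inner k k' &
      dense (lspan [set t h k | h in setT & k in setT])].

(* AB, with the elementary tensors [tens a b], is the norm closure of the span
   of the operators piA a (x) piB b in the bounded operators on the Hilbert
   tensor product of H and K, for some faithful piA on H and piB on K; [pi]
   is the inclusion of AB in these operators. *)
Definition min_tensor (A B AB : cstarAlgType R) (tens : A -> B -> AB) :=
  exists (H K L : hilbertType R) (t : H -> K -> L)
    (piA : A -> H -> H) (piB : B -> K -> K) (pi : AB -> L -> L),
  [/\ faithful_representation piA /\ faithful_representation piB,
      hilbert_tensor t,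
      representation pi /\ (forall c, `|c| = (opnorm (pi c))%:C%C),
      forall a b h k, pi (tens a b) (t h k) = t (piA a h) (piB b k) &
      dense (lspan [set tens a b | a in setT & b in setT])].

End Representations.

Section Couplings.
Variable R : realType.

Definition cpos (A : cstarAlgType R) (x : A) := exists y, x = star y ** y.

Definition cle (A : cstarAlgType R) (x y : A) := cpos (y - x).

Definition positive_functional (A : cstarAlgType R)
  (f : {linear A -> R[i]^o}) := forall x, cpos x -> 0 <= (f x : R[i]).

Definition state (A : cstarAlgType R) (f : {linear A -> R[i]^o}) :=
  positive_functional f /\ f cone = 1.

Variables (A B AB : cstarAlgType R) (tens : A -> B -> AB).
Variables (phi : {linear A -> R[i]^o}) (psi : {linear B -> R[i]^o}).

Definition couplings : set {linear AB -> R[i]^o} :=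
  [set sigma | [/\ positive_functional sigma,
     forall a, sigma (tens a cone) = phi a &
     forall b, sigma (tens cone b) = psi b]].

(* [complex.Re] loses nothing: sigma T is real for T positive. *)
Definition coupling_values (T : AB) : set R :=
  [set complex.Re (sigma T) | sigma in couplings].

Definition coupling_sup (T : AB) : R := sup (coupling_values T).

End Couplings.

(* Main.v *)
Require Import Defs.
From HB Require Import structures.
From mathcomp Require Import all_boot all_order all_algebra.
From mathcomp Require Import sesquilinear complex.
From mathcomp Require Import all_classical all_reals all_analysis.
From mathcomp Require Import ring lra.

Set Implicit Arguments.
Unset Strict Implicit.
Unset Printing Implicit Defensive.

Import Order.TTheory GRing.Theory Num.Theory.
Import numFieldNormedType.Exports.

Local Open Scope classical_set_scope.
Local Open Scope ring_scope.

(* A coupling is a positive functional with value 1 at the unit, hence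
   1-Lipschitz in real part, so [alpha] is a real sublinear functional on all of
   the tensor product; convexity, monotonicity, norm continuity and weak* lower
   semicontinuity follow at once.  Couplings exist by Hahn-Banach below the
   numerical range over product vectors, because a state never exceeds the
   numerical range of a faithful representation.  When T_k decreases to T and L
   is the limit of the alpha(T_k), Hahn-Banach below [alpha] yields one coupling
   s with L <= s(T_k) for all k, hence L <= s(T) <= alpha(T).

   The spectral input is reduced to square roots of 1 - x for |x| <= 1, obtained
   from the iteration y |-> (x + y^2) / 2. *)

(** * Complex-valued norms and a telescoping convergence criterion *)

Section ComplexNorm.
Variable R : realType.

Lemma normReC (V : normedZmodType R[i]) (x : V) :
  `|x| = (complex.Re `|x|)%:C%C.
Proof. by rewrite RRe_real// ger0_real. Qed.

Lemma Re_norm_ge0 (V : normedZmodType R[i]) (x : V) : 0 <= complex.Re `|x|.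
Proof. by have := normr_ge0 x; rewrite lecE => /andP[]. Qed.

Lemma telescope_normB (V : normedZmodType R[i]) (u : nat -> V) (r : nat -> R) :
  (forall n, `|u n.+1 - u n| <= (r n.+1 - r n)%:C%C) ->
  forall m n, (m <= n)%N -> `|u n - u m| <= (r n - r m)%:C%C.
Proof.
move=> ur m n /subnKC <-; elim: (n - m)%N => [|k IH].
  by rewrite addn0 !subrr normr0.
rewrite addnS -(subrKA (u (m + k)%N)) -(subrKA (r (m + k)%N)) rmorphD /=.
by rewrite (le_trans (ler_normD _ _))// lerD.
Qed.

(** Past an index [N] where [r] is within [e] of its limit, every [u n] stays in the [e]-ball around
    [u N], so [u] is Cauchy. *)
Lemma telescope_is_cvg (V : completeNormedModType R[i]) (u : nat -> V)
    (r : nat -> R) : nondecreasing_seq r -> has_ubound (range r) ->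
  (forall n, `|u n.+1 - u n| <= (r n.+1 - r n)%:C%C) -> cvgn u.
Proof.
move=> rnd rub /telescope_normB ur; apply/cauchy_cvgP/cauchy_exP => e e0.
have eE : e = (complex.Re e)%:C%C by rewrite RRe_real// gtr0_real.
have re0 : 0 < complex.Re e by move: e0; rewrite ltcE => /andP[].
have cr : cvgn r by exact: nondecreasing_is_cvgn.
have := cr => /cvgrPdist_lt/(_ _ re0)[N _ rN].
exists (u N), N => // n /= Nn; rewrite -ball_normE /= distrC.
rewrite (le_lt_trans (ur _ _ Nn))// eE ltcR.
have rlim : r n <= limn r by exact: nondecreasing_cvgn_le.
by have := rN _ (leqnn N); rewrite ltr_norml => /andP[_]; lra.
Qed.

End ComplexNorm.

(** * Elementary algebra, norm identities and continuity in a C*-algebra *)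

Section CStarTheory.
Variables (R : realType) (A : cstarAlgType R).
Implicit Types x y z a : A.

Lemma cmulNx x y : (- x) ** y = - (x ** y).
Proof. by rewrite -scaleN1r cmulZl scaleN1r. Qed.

Lemma cmulxN x y : x ** (- y) = - (x ** y).
Proof. by rewrite -scaleN1r cmulZr scaleN1r. Qed.

Lemma cmulBl x y z : (x - y) ** z = x ** z - y ** z.
Proof. by rewrite cmulDl cmulNx. Qed.

Lemma cmulBr x y z : z ** (x - y) = z ** x - z ** y.
Proof. by rewrite cmulDr cmulxN. Qed.

Lemma cmul0x x : 0 ** x = 0.
Proof. by rewrite -[0](subrr x) cmulBl !subrr. Qed.

Lemma cmulx0 x : x ** 0 = 0.
Proof. by rewrite -[0](subrr x) cmulBr !subrr. Qed.

Lemma starZr (r : R) x : star (r%:C%C *: x) = r%:C%C *: star x.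
Proof. by rewrite starZ conj_Creal// complex_real. Qed.

Lemma starN x : star (- x) = - star x.
Proof. by have := starZr (-1) x; rewrite rmorphN1 !scaleN1r. Qed.

Lemma starB x y : star (x - y) = star x - star y.
Proof. by rewrite starD starN. Qed.

Lemma star0 : star (0 : A) = 0.
Proof. by rewrite -(subrr 0) starB !subrr. Qed.

Lemma star1 : star cone = cone :> A.
Proof.
have := starM (star cone : A) cone.
by rewrite starK !cmulx1 starK => <-.
Qed.

Lemma norm_star x : `|star x| = `|x|.
Proof.
have le y : `|y| <= `|star y|.
  have [->|y0] := eqVneq y 0; first by rewrite star0.
  rewrite -(ler_pM2r (_ : 0 < `|y|)) ?normr_gt0//.
  by rewrite -expr2 -cnorm_star cnormM.
by apply/eqP; rewrite eq_le le -{2}(starK x) le.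
Qed.

(** The unit is a selfadjoint idempotent, so its norm equals its own square; the value 0 occurs in
    the zero algebra. *)
Lemma norm_cone_le1 : `|cone : A| <= 1.
Proof.
have := cnorm_star (cone : A); rewrite star1 cmul1x.
have [->//|n0] := eqVneq `|cone : A| 0.
by rewrite expr2 -{1}[`|cone|]mulr1 => /(mulfI n0) <-.
Qed.

Lemma norm_sqr_selfadj x : star x = x -> `|x ** x| = `|x| ^+ 2.
Proof. by move=> sx; rewrite -cnorm_star sx. Qed.

Lemma norm_sqr_le1 x : `|x| <= 1 -> `|x ** x| <= 1.
Proof.
by move=> x1; rewrite (le_trans (cnormM _ _))// mulr_ile1.
Qed.

Lemma continuous_cmull z : continuous (fun x => z ** x).
Proof.
have lz : linear (fun x => z ** x) by move=> c x y; rewrite cmulDr cmulZr.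
pose g : {linear A -> A} :=
  HB.pack (fun x => z ** x) (GRing.isLinear.Build _ _ _ _ _ lz).
apply: (@bounded_linear_continuous _ _ _ g); apply/linear_boundedP.
exists `|z|; split=> [|r zr x]; first exact: normr_real.
by rewrite (le_trans (cnormM z x))// ler_wpM2r// ltW.
Qed.

Lemma continuous_cmulr z : continuous (fun x => x ** z).
Proof.
have lz : linear (fun x => x ** z) by move=> c x y; rewrite cmulDl cmulZl.
pose g : {linear A -> A} :=
  HB.pack (fun x => x ** z) (GRing.isLinear.Build _ _ _ _ _ lz).
apply: (@bounded_linear_continuous _ _ _ g); apply/linear_boundedP.
exists `|z|; split=> [|r zr x]; first exact: normr_real.
by rewrite (le_trans (cnormM x z))// mulrC ler_wpM2r// ltW.
Qed.

Lemma continuous_star : continuous (@star R A).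
Proof.
move=> x; apply/cvgrPdist_lt => e e0.
apply: filterS (nbhsx_ballx x e e0) => y.
by rewrite -ball_normE /= -starB norm_star.
Qed.

End CStarTheory.

(** * Square roots and positive elements of C*-algebras *)

Section SquareRoot.
Variables (R : realType) (A : cstarAlgType R).
Implicit Types x y z a : A.

(** Fixed points [y] of this step are exactly the solutions of
    [(cone - y) ** (cone - y) = cone - x]. *)
Definition sqrt_step x y : A := (2^-1)%:C%C *: (x + y ** y).

Definition sqrt_seq x n : A := iter n (sqrt_step x) 0.

(* The scalar iteration at [x = 1]; its increments dominate the norms of those of
   [sqrt_seq], and it is increasing and bounded. *)
Definition sqrt_majorant n : R := iter n (fun r => 2^-1 * (1 + r ^+ 2)) 0.

Lemma sqrt_majorant_itv n : 0 <= sqrt_majorant n <= 1.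
Proof.
elim: n => [|n /andP[r0 r1]]; first by rewrite /= lexx ler01.
rewrite /sqrt_majorant iterS -/(sqrt_majorant n).
by apply/andP; split; nra.
Qed.

Lemma sqrt_majorantS n :
  sqrt_majorant n.+1 = 2^-1 * (1 + sqrt_majorant n ^+ 2).
Proof. by []. Qed.

Lemma sqrt_seqS x n :
  sqrt_seq x n.+1 = (2^-1)%:C%C *: (x + sqrt_seq x n ** sqrt_seq x n).
Proof. by []. Qed.

(** Each iterate is a polynomial in [x]. Taking [z] to be an iterate shows that the iterates commute
    with one another. *)
Lemma sqrt_seq_comm x z n : z ** x = x ** z ->
  z ** sqrt_seq x n = sqrt_seq x n ** z.
Proof.
move=> zx; elim: n => [|n IH]; first by rewrite cmulx0 cmul0x.
rewrite sqrt_seqS cmulZr cmulZl cmulDr cmulDl zx.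
by rewrite cmulA IH -cmulA IH cmulA.
Qed.

Lemma sqrt_seq_norm x n : `|x| <= 1 ->
  `|sqrt_seq x n| <= (sqrt_majorant n)%:C%C.
Proof.
move=> x1; elim: n => [|n IH]; first by rewrite normr0.
rewrite sqrt_seqS sqrt_majorantS normrZ rmorphM /= ger0_norm ?ler0c ?invr_ge0//.
rewrite ler_wpM2l ?ler0c ?invr_ge0// rmorphD rmorphXn /=.
rewrite (le_trans (ler_normD _ _))// lerD// (le_trans (cnormM _ _))//.
by rewrite expr2 ler_pM.
Qed.

(** Since consecutive iterates commute, the difference of their squares factors as
    [(u + v) ** (u - v)], in parallel with [(p + q) * (p - q)] for the majorant. *)
Lemma sqrt_seq_dist x n : `|x| <= 1 ->
  `|sqrt_seq x n.+1 - sqrt_seq x n| <=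
    (sqrt_majorant n.+1 - sqrt_majorant n)%:C%C.
Proof.
move=> x1; elim: n => [|n IH].
  rewrite sqrt_seqS sqrt_majorantS /= cmul0x addr0 subr0 subr0 expr0n addr0 mulr1.
  rewrite normrZ ger0_norm ?ler0c ?invr_ge0//.
  by rewrite -[leRHS]mulr1 ler_wpM2l ?ler0c ?invr_ge0.
have comm : sqrt_seq x n.+1 ** sqrt_seq x n = sqrt_seq x n ** sqrt_seq x n.+1.
  by rewrite sqrt_seq_comm// -sqrt_seq_comm.
rewrite 2!sqrt_seqS [X in (X - _)%:C%C]sqrt_majorantS.
rewrite [X in (_ - X)%:C%C]sqrt_majorantS -sqrt_seqS.
set u := sqrt_seq x n.+1 in IH comm *; set v := sqrt_seq x n in IH comm *.
have -> : (2^-1)%:C%C *: (x + u ** u) - (2^-1)%:C%C *: (x + v ** v) =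
    (2^-1)%:C%C *: ((u + v) ** (u - v)).
  rewrite -scalerBr opprD addrACA subrr add0r cmulBr !cmulDl comm opprD.
  by rewrite addrA addrK.
set p := sqrt_majorant n.+1 in IH *; set q := sqrt_majorant n in IH *.
have -> : 2^-1 * (1 + p ^+ 2) - 2^-1 * (1 + q ^+ 2) =
   2^-1 * ((p + q) * (p - q)) by ring.
rewrite normrZ [X in _ <= X]rmorphM /= ger0_norm ?ler0c ?invr_ge0//.
rewrite ler_wpM2l ?ler0c ?invr_ge0// rmorphM /= (le_trans (cnormM _ _))//.
rewrite ler_pM// rmorphD /= (le_trans (ler_normD _ _))//.
by rewrite lerD// sqrt_seq_norm.
Qed.

(** The iteration converges by comparison with the majorant, and its limit is a fixed point that
    inherits the closed properties of the iterates. The commutation clause stands in for functional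
    calculus: roots of commuting elements can be multiplied freely. *)
Lemma sqrt_one_sub x : star x = x -> `|x| <= 1 ->
  exists y, [/\ star y = y, `|y| <= 1, (cone - y) ** (cone - y) = cone - x &
    forall z, z ** x = x ** z -> z ** y = y ** z].
Proof.
move=> sx x1.
have /cvg_ex[y uy] : cvgn (sqrt_seq x).
  apply: (@telescope_is_cvg _ _ _ sqrt_majorant) => [||n].
  - apply/nondecreasing_seqP => n; rewrite sqrt_majorantS.
    have := sqrt_majorant_itv n; set r := sqrt_majorant n => /andP[r0 r1].
    by nra.
  - by exists 1 => _ [n _ <-]; have /andP[] := sqrt_majorant_itv n.
  - exact: sqrt_seq_dist.
have comm z : z ** x = x ** z -> z ** y = y ** z.
  move=> zx; apply: (@cvg_unique _ (@norm_hausdorff _ _)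
    (z ** sqrt_seq x n @[n --> \oo])).
    exact: (cvg_comp _ _ uy (@continuous_cmull _ _ z y)).
  rewrite /= (eq_cvg _ _ (fun n => sqrt_seq_comm n zx)).
  exact: (cvg_comp _ _ uy (@continuous_cmulr _ _ z y)).
have sy : star y = y.
  apply: (@cvg_unique _ (@norm_hausdorff _ _) (star (sqrt_seq x n) @[n --> \oo])).
    exact: (cvg_comp _ _ uy (@continuous_star _ _ y)).
  suff ss n : star (sqrt_seq x n) = sqrt_seq x n.
    by rewrite /= (eq_cvg _ _ ss).
  elim: n => [|n IH]; first by rewrite star0.
  by rewrite sqrt_seqS starZr starD sx starM IH.
have nu n : `|sqrt_seq x n| <= 1.
  apply: (le_trans (sqrt_seq_norm _ x1)).
  by rewrite (_ : 1 = 1%:C%C)// lecR; have /andP[] := sqrt_majorant_itv n.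
have ny : `|y| <= 1.
  rewrite real_leNgt ?normr_real ?real1//; apply/negP => y1.
  have e0 : 0 < `|y| - 1 by rewrite subr_gt0.
  have /cvgrPdist_lt/(_ _ e0)[N _ /(_ N (leqnn N)) /=] := uy.
  move=> h; suff : `|y| < `|y| by rewrite ltxx.
  rewrite -{1}(subrK (sqrt_seq x N) y) (le_lt_trans (ler_normD _ _))//.
  by rewrite -[ltRHS](subrK 1) ltr_leD.
have yy : sqrt_seq x n ** sqrt_seq x n @[n --> \oo] --> y ** y.
  apply/cvgrPdist_lt => e e0; have e2 : 0 < e / 2 by rewrite divr_gt0.
  have /cvgrPdist_lt/(_ _ e2) := uy.
  apply: filterS => n; set u := sqrt_seq x n => yu.
  have -> : y ** y - u ** u = y ** (y - u) + (y - u) ** u.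
    by rewrite cmulBr cmulBl addrA subrK.
  rewrite (le_lt_trans (ler_normD _ _))// [e]splitr ltr_leD//.
    by rewrite (le_lt_trans (cnormM _ _))// (le_lt_trans _ yu)// ler_piMl.
  rewrite (le_trans (cnormM _ _))// (le_trans _ (ltW yu))//.
  by rewrite ler_piMr// nu.
have yE : y = (2^-1)%:C%C *: (x + y ** y).
  apply: (@cvg_unique _ (@norm_hausdorff _ _) (sqrt_seq x n.+1 @[n --> \oo])).
    by have := uy; rewrite -(cvg_shiftS (sqrt_seq x)).
  rewrite /= (eq_cvg _ _ (sqrt_seqS x)).
  by apply: cvgZr; apply: cvgD => //; exact: cvg_cst.
exists y; split => //.
have y2 : y + y = x + y ** y.
  rewrite {1 2}yE -scalerDl -rmorphD /= (_ : 2^-1 + 2^-1 = 1 :> R) ?scale1r//.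
  by lra.
have -> : x = y + y - y ** y by rewrite y2 addrK.
rewrite cmulBl cmul1x cmulBr cmulx1 !opprB addrACA opprD.
by rewrite [RHS]addrA.
Qed.

End SquareRoot.

Section Selfadjoint.
Variables (R : realType) (A : cstarAlgType R).
Implicit Types x y z a : A.

Lemma cposZ (r : R) x : 0 <= r -> cpos x -> cpos (r%:C%C *: x).
Proof.
move=> r0 [y ->]; exists ((Num.sqrt r)%:C%C *: y).
rewrite starZr cmulZl cmulZr scalerA -rmorphM /=.
by rewrite -expr2 sqr_sqrtr.
Qed.

Lemma cpos_one_sub x : star x = x -> `|x| <= 1 -> cpos (cone - x).
Proof.
move=> sx /(sqrt_one_sub sx)[y [sy _ <- _]].
by exists (cone - y); rewrite starB star1 sy.
Qed.

(* [a + i sqrt (1 - a^2)] is unitary, so its imaginary part has norm at most 1;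
   this replaces the spectral theorem. *)
Lemma norm_one_sub_sqr a : star a = a -> `|a| <= 1 -> `|cone - a ** a| <= 1.
Proof.
move=> sa a1.
have saa : star (a ** a) = a ** a by rewrite starM sa.
have /(sqrt_one_sub saa)[y [sy _ + comm]] := norm_sqr_le1 a1.
set s := cone - y => s2.
have ss : star s = s by rewrite starB star1 sy.
have as_ : a ** s = s ** a.
  by rewrite cmulBr cmulBl cmulx1 cmul1x comm// cmulA.
pose u := a + 'i%C *: s.
have su : star u = a - 'i%C *: s.
  rewrite starD sa starZ ss (_ : _^* = - 'i%C) ?scaleNr//.
  exact: conjCi.
have uu : star u ** u = cone.
  rewrite su cmulBl !cmulDr !cmulZl !cmulZr as_ scalerA s2.
  rewrite -expr2 sqr_i scaleN1r opprB addrACA subrr addr0.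
  by rewrite addrC subrK.
have nu : `|u| <= 1.
  rewrite -(@ler_pXn2r _ 2) ?nnegrE// expr1n -cnorm_star uu.
  exact: norm_cone_le1.
have us : u - star u = ('i%C *+ 2) *: s.
  by rewrite su opprB addrC addrA subrK -scalerDl.
rewrite -s2 norm_sqr_le1// -(@ler_pM2l _ 2)// mulr1.
have -> : 2 * `|s| = `|u - star u|.
  rewrite us normrZ normrMn; congr (_ * _).
  by rewrite complexiE normCi.
rewrite (le_trans (ler_normB _ _))// norm_star.
by rewrite -[2]/(1 + 1) lerD.
Qed.

(* [q ** q] is the absolute value of [a], and [w] is twice its negative part. *)
Lemma negative_part a : star a = a -> `|a| <= 1 ->
  exists q w, [/\ star w = w, w = q ** q - a, star q = q,
    w ** a ** w = - (star (q ** w) ** (q ** w)) &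
    w ** w = (q ** (q ** w)) *+ 2].
Proof.
move=> sa a1.
have saa : star (cone - a ** a) = cone - a ** a by rewrite starB star1 starM sa.
have [y [sy y1 + ycomm]] := sqrt_one_sub saa (norm_one_sub_sqr sa a1).
rewrite subKr; set t := cone - y => t2.
have [z [sz _ + zcomm]] := sqrt_one_sub sy y1.
rewrite -/t; set q := cone - z => q2.
have sq : star q = q by rewrite starB star1 sz.
have st : star t = t by rewrite starB star1 sy.
have ay : a ** y = y ** a.
  by apply: ycomm; rewrite cmulBr cmulBl cmulx1 cmul1x cmulA.
have az : a ** q = q ** a.
  by rewrite cmulBr cmulBl cmulx1 cmul1x zcomm.
have at_ : a ** t = t ** a by rewrite cmulBr cmulBl cmulx1 cmul1x ay.
exists q, (t - a); split => //.
- by rewrite starB st sa.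
- by rewrite q2.
- set w := t - a.
  have sw : star w = w by rewrite starB st sa.
  have qw : q ** w = w ** q.
    by rewrite (cmulBr t a q) (cmulBl t a q) -az -q2 cmulA.
  have aw : w ** a = - (w ** t).
    by rewrite (cmulBl t a a) (cmulBl t a t) at_ t2 opprB.
  by rewrite starM sw sq aw cmulNx -q2 !cmulA.
- rewrite cmulA q2 (cmulBl t a (t - a)) (cmulBr t a t) (cmulBr t a a) at_ t2.
  by rewrite opprB mulr2n.
Qed.

End Selfadjoint.

(** * Positivity tested in a faithful representation *)

Section Representation.
Variables (R : realType) (A : cstarAlgType R) (H : hilbertType R).
Variable pi : A -> H -> H.
Hypothesis rpi : representation pi.

Lemma rep_linear a : linear (pi a).
Proof. by have [/(_ a)[]] := rpi. Qed.

Lemma rep_continuous a : continuous (pi a).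
Proof. by have [/(_ a)[]] := rpi. Qed.

Lemma rep0 a : pi a 0 = 0.
Proof.
by have := rep_linear a 1 0 0; rewrite scale1r addr0 scale1r => /eqP;
  rewrite -subr_eq0 opprD addNKr oppr_eq0 => /eqP.
Qed.

Lemma repDl a b h : pi (a + b) h = pi a h + pi b h.
Proof. by have [_ /(_ h 1 a b)] := rpi; rewrite !scale1r. Qed.

Lemma rep0l h : pi 0 h = 0.
Proof. by apply: (@addrI _ (pi 0 h)); rewrite -repDl !addr0. Qed.

Lemma repZl c a h : pi (c *: a) h = c *: pi a h.
Proof. by have [_ /(_ h c a 0)] := rpi; rewrite !addr0 rep0l addr0. Qed.

Lemma repNl a h : pi (- a) h = - pi a h.
Proof. by rewrite -scaleN1r repZl scaleN1r. Qed.

Lemma rep1 h : pi cone h = h.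
Proof. by have [_ _ ->] := rpi. Qed.

Lemma repM a b h : pi (a ** b) h = pi a (pi b h).
Proof. by have [_ _ _ ->] := rpi. Qed.

Lemma rep_star a h k : inner (pi (star a) h) k = inner h (pi a k).
Proof. by have [_ _ _ _] := rpi. Qed.

Lemma inner_rep_sqr a h : inner (pi (star a ** a) h) h = `|pi a h| ^+ 2.
Proof. by rewrite repM rep_star -normE_inner. Qed.

(** With [w] twice the negative part of [a], the squared norm of [pi (q ** w) h] is minus the
    quadratic form of [a] at [pi w h], hence zero. Faithfulness gives [q ** w = 0], so [w ** w = 0],
    [w = 0] and [a = q ** q]. *)
Lemma cpos_of_rep a : injective pi -> star a = a ->
  (forall h, 0 <= complex.Re (inner (pi a h) h)) -> cpos a.
Proof.
move=> ipi; have [->|a0] := eqVneq a 0.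
  by move=> *; exists 0; rewrite cmulx0.
wlog a1 : a a0 / `|a| <= 1 => [hw|] sa pos.
  have na : 0 < complex.Re `|a|.
    by have : 0 < `|a| by [rewrite normr_gt0]; rewrite ltcE => /andP[].
  set r := (complex.Re `|a|)^-1.
  have r0 : 0 < r by rewrite invr_gt0.
  have -> : a = (complex.Re `|a|)%:C%C *: (r%:C%C *: a).
    by rewrite scalerA -rmorphM /= mulfV ?gt_eqF// scale1r.
  apply: cposZ (ltW na) _; apply: hw.
  - rewrite scaler_eq0 negb_or a0 andbT -(rmorph0 (real_complex R)).
    by rewrite (inj_eq (@complexI _)) gt_eqF.
  - by rewrite normrZ ger0_norm ?ler0c ?(ltW r0)// normReC -rmorphM /= mulVf ?gt_eqF.
  - by rewrite starZr sa.
  - move=> h; rewrite repZl linearZl /=.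
    have /= := pos h; case: (inner _ _) => u v /= u0.
    by rewrite mul0r subr0 mulr_ge0// ltW.
have [q [w [sw wE sq waw ww]]] := negative_part sa a1.
have qw0 : q ** w = 0.
  apply: ipi; apply/funext => h; rewrite rep0l; apply/eqP.
  rewrite -normr_le0 -(@ler_pXn2r _ 2) ?nnegrE// expr0n /=.
  have nE : `|pi (q ** w) h| ^+ 2 = - inner (pi a (pi w h)) (pi w h).
    rewrite -inner_rep_sqr -[_ ** (q ** w)]opprK -waw repNl linearNl /=.
    by rewrite -cmulA repM -{1}sw rep_star repM.
  have := congr1 (@complex.Re R) nE; rewrite normReC -rmorphXn /= raddfN /=.
  by have := pos (pi w h); rewrite lecR => ? ->; rewrite oppr_le0.
have w0 : w = 0.
  apply/eqP; rewrite -normr_eq0 -sqrf_eq0.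
  by rewrite -norm_sqr_selfadj// ww qw0 cmulx0 mul0rn normr0.
by exists q; apply/eqP; rewrite sq eq_sym -subr_eq0 -wE w0.
Qed.
End Representation.

(** * Boundedness of positive functionals *)

Section PositiveFunctional.
Variables (R : realType) (A : cstarAlgType R) (f : {linear A -> R[i]^o}).
Hypothesis fpos : positive_functional f.
Implicit Types x y z a : A.

Definition re_part x : A := (2^-1)%:C%C *: (x + star x).

Lemma re_part_selfadj x : star (re_part x) = re_part x.
Proof. by rewrite starZr starD starK addrC. Qed.

Lemma norm_re_part x : `|re_part x| <= `|x|.
Proof.
rewrite normrZ ger0_norm ?ler0c ?invr_ge0//.
rewrite -(@ler_pM2l _ 2)// mulrA (_ : 2 * _ = 1); last first.
  by rewrite fmorphV rmorph_nat mulfV ?pnatr_eq0.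
rewrite mul1r (le_trans (ler_normD _ _))// norm_star.
by rewrite mulr_natl mulr2n.
Qed.

Lemma pos_cone_ge0 : 0 <= (f cone : R[i]).
Proof. by apply: fpos; exists cone; rewrite star1 cmul1x. Qed.

(** After division by its norm, [x] can be subtracted from the unit leaving a positive element, on
    which [f] is nonnegative. *)
Lemma pos_selfadj_le x : star x = x -> (f x : R[i]) <= `|x| * f cone.
Proof.
move=> sx; have [->|x0] := eqVneq x 0.
  by rewrite linear0 normr0 mul0r.
have nx : 0 < `|x| by rewrite normr_gt0.
have : 0 <= (f (cone - (complex.Re `|x|)^-1%:C%C *: x) : R[i]).
  apply/fpos/cpos_one_sub; first by rewrite starZr sx.
  by rewrite fmorphV /= -normReC normrZ normfV normr_id mulVf ?gt_eqF.
rewrite linearB linearZ /= subr_ge0 fmorphV /= -normReC.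
by rewrite -(ler_pM2l nx) [_ *: _]/(_ * _) mulrA mulfV ?gt_eqF// mul1r.
Qed.

(** Comparable elements of [R[i]] have equal imaginary parts, so the previous inequality already
    contains reality. *)
Lemma pos_selfadj_real x : star x = x -> complex.Im (f x) = 0.
Proof.
move=> /pos_selfadj_le; rewrite lecE => /andP[/eqP <- _].
have := pos_cone_ge0; rewrite lecE => /andP[/eqP h _].
by rewrite normReC /=; case: (f cone) h => u v /= ->; rewrite mulr0 mul0r addr0.
Qed.

(** The element ['i%C *: (x - star x)] is selfadjoint; reality of its value says that [f x] and
    [f (star x)] have the same real part. *)
Lemma pos_Re_part x : complex.Re (f x) = complex.Re (f (re_part x)).
Proof.
have sy : star ('i%C *: (x - star x)) = 'i%C *: (x - star x).
  rewrite starZ starB starK (_ : 'i%C^* = - 'i%C) ?scaleNr -?scalerN ?opprB//.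
  exact: conjCi.
have := pos_selfadj_real sy.
rewrite /re_part !(linearZ, linearB, linearD) /= ![_ *: _]/(_ * _).
case: (f x) (f (star x)) => a b [c d] /=.
by rewrite !mul0r !mul1r !add0r subr0 => /eqP; rewrite subr_eq0 => /eqP <-; field.
Qed.

Lemma pos_Re_le x : complex.Re (f x) <= complex.Re `|x| * complex.Re (f cone).
Proof.
rewrite pos_Re_part.
have := pos_selfadj_le (re_part_selfadj x); rewrite lecE => /andP[_] /le_trans.
apply; rewrite normReC.
have -> (u : R) (v : R[i]) : complex.Re (u%:C%C * v) = u * complex.Re v.
  by case: v => v w /=; rewrite mul0r subr0.
rewrite ler_wpM2r//; first by have := pos_cone_ge0; rewrite lecE => /andP[].
by have := norm_re_part x; rewrite lecE => /andP[].
Qed.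

(** The imaginary part is, up to sign, the real part at ['i%C *: x], so the real bound applies to
    both; the factor 2 comes from adding them. *)
Lemma pos_bounded x : `|f x : R[i]| <= 2 * (f cone * `|x|).
Proof.
have h y : `|complex.Re (f y)| <= complex.Re `|y| * complex.Re (f cone).
  rewrite ler_norml pos_Re_le andbT lerNl -raddfN -linearN -normrN.
  exact: pos_Re_le.
have fc : f cone = (complex.Re (f cone))%:C%C :> R[i].
  by rewrite RRe_real// ger0_real// pos_cone_ge0.
have im : `|complex.Im (f x)| <= complex.Re `|x| * complex.Re (f cone).
  have := h ('i%C *: x); rewrite linearZ /= normrZ complexiE normCi mul1r.
  rewrite -complexiE (_ : 'i%C *: f x = f x * 'i%C); last exact: mulrC.
  by rewrite ReiNIm normrN.
rewrite fc mulrC.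
rewrite [f x]complexE (le_trans (ler_normD _ _))//.
rewrite normrM complexiE normCi mul1r mulrC mulr_natl mulr2n.
rewrite (normReC x) -!rmorphM /=.
have nC (r : R) : `|r%:C%C| = `|r|%:C%C :> R[i].
  by rewrite normc_def /= expr0n addr0 sqrtr_sqr.
by rewrite !nC lerD// lecR mulrC ?(mulrC (complex.Re (f cone))).
Qed.

Lemma pos_continuous : continuous f.
Proof.
apply: (@bounded_linear_continuous _ _ _ f); apply/linear_boundedP.
exists (2 * f cone); split.
  by rewrite ger0_real// mulr_ge0// pos_cone_ge0.
move=> r fr x; rewrite (le_trans (pos_bounded x))// mulrA ler_wpM2r//.
exact: ltW.
Qed.

End PositiveFunctional.

(** * Hahn-Banach for real sublinear functionals *)

Section HahnBanach.
Variables (R : realType) (V : lmodType R[i]).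
Implicit Types (p q : V -> R) (x y v : V) (S : set (V * R)).

Definition sublinear p :=
  (forall x y, p (x + y) <= p x + p y) /\
  (forall (r : R) x, 0 <= r -> p (r%:C%C *: x) = r * p x).

Lemma sublinearI p : (forall x y, p (x + y) <= p x + p y) -> p 0 <= 0 ->
  (forall (r : R) x, 0 < r -> p (r%:C%C *: x) <= r * p x) -> sublinear p.
Proof.
move=> pD p0 pZ; split=> // r x; rewrite le_eqVlt => /predU1P[<-|r0].
  rewrite mul0r scale0r; have := pD 0 0; rewrite addr0 => p00.
  by apply/eqP; rewrite eq_le p0 /=; lra.
apply/eqP; rewrite eq_le pZ//= -ler_pdivlMl//.
rewrite -{1}(scale1r x) (_ : 1 = (r^-1)%:C%C * r%:C%C).
  by rewrite -scalerA pZ// invr_gt0.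
by rewrite -rmorphM /= mulVf// gt_eqF.
Qed.

Lemma sublinear0 p : sublinear p -> p 0 = 0.
Proof. by case=> _ /(_ 0 0 (lexx _)); rewrite scale0r mul0r. Qed.

Lemma sublinearN_ge p x : sublinear p -> - p (- x) <= p x.
Proof.
move=> sp; have := sp.1 x (- x); rewrite subrr (sublinear0 sp); lra.
Qed.

(** A pair [(v, c)] encodes the constraint [c <= complex.Re (f v)] on a functional [f] to be found;
    such constraints are stable under sums and positive multiples. *)
Definition convex_cone S :=
  [/\ S (0, 0), forall u w, S u -> S w -> S (u.1 + w.1, u.2 + w.2) &
    forall (r : R) u, 0 < r -> S u -> S (r%:C%C *: u.1, r * u.2)].

(** Take for [q x] the infimum of [p (x + u.1) - u.2] over [S]. That [S] lies below [p] makes it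
    finite, with lower bound [- p (- x)]; the term of [u] itself gives the constraint at [- u.1]. *)
Lemma sublinear_below_cone p S : sublinear p -> convex_cone S ->
  (forall u, S u -> u.2 <= p u.1) ->
  exists q, [/\ sublinear q, forall x, q x <= p x &
    forall u, S u -> q (- u.1) <= - u.2].
Proof.
move=> sp [S0 SD SZ] Sp; have [pD pZ] := sp.
pose E x := [set p (x + u.1) - u.2 | u in S].
have Elb x : lbound (E x) (- p (- x)).
  move=> _ [u Su <-]; have := Sp _ Su; have := pD (x + u.1) (- x).
  by rewrite addrC addKr; lra.
have E0 x : E x !=set0 by exists (p (x + 0) - 0); exists (0, 0).
have Einf x : has_inf (E x) by split=> //; exists (- p (- x)).
have qle x u : S u -> inf (E x) <= p (x + u.1) - u.2.
  by move=> Su; apply: ge_inf; [exists (- p (- x))|exists u].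
exists (fun x => inf (E x)); split.
- apply: sublinearI => [x y||r x r0].
  + rewrite -lerBlDr; apply: lb_le_inf => // _ [u Su <-].
    rewrite lerBlDr [leRHS]addrC -lerBlDr; apply: lb_le_inf => // _ [w Sw <-].
    rewrite lerBlDr; apply: le_trans (qle _ _ (SD _ _ Su Sw)) _ => /=.
    by have := pD (x + u.1) (y + w.1); rewrite addrACA; lra.
  + by have := qle 0 _ S0; rewrite /= addr0 subr0 (sublinear0 sp).
  + rewrite -ler_pdivrMl//; apply: lb_le_inf => // _ [u Su <-].
    rewrite ler_pdivrMl//; apply: le_trans (qle _ _ (SZ _ _ r0 Su)) _ => /=.
    by rewrite -scalerDr pZ ?(ltW r0)// mulrBr.
- by move=> x; have := qle x _ S0; rewrite /= addr0 subr0.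
- move=> u Su; have := qle (- u.1) _ Su.
  by rewrite addNr (sublinear0 sp) sub0r.
Qed.

(** Zorn's lemma on the sublinear minorants of [p]: the pointwise infimum of a chain is again one,
    finite because every minorant is at least [- p (- x)] at [x]. *)
Lemma minimal_sublinear p : sublinear p ->
  exists q, [/\ sublinear q, forall x, q x <= p x &
    forall q', sublinear q' -> (forall x, q' x <= q x) -> q' = q].
Proof.
move=> sp.
pose T := {q : V -> R | sublinear q /\ forall x, q x <= p x}.
(* The order is reversed, so that maximal elements are pointwise minimal functionals. *)
pose le (s t : T) : bool := `[< forall x, sval t x <= sval s x >].
have leP s t : le s t <-> forall x, sval t x <= sval s x.
  by split=> [/asboolP//|h]; exact/asboolP.
have [| | | |[q [sq qp]] qmin] := @Zorn T le.
- by move=> t; apply/leP.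
- move=> r s t /leP rs /leP st; apply/leP => x.
  exact: le_trans (st x) (rs x).
- move=> [s hs] [t ht] /leP /= st /leP /= ts.
  have e : s = t by apply/funext => x; apply/eqP; rewrite eq_le st ts.
  by move: hs; rewrite e => hs; congr exist; exact: Prop_irrelevance.
(* The infimum needs a nonempty chain; the empty chain is bounded by [p] itself. *)
- move=> C Ctot; have [[c0 Cc0]|C0] := pselect (C !=set0); last first.
    exists (exist _ p (conj sp (fun x => lexx _))) => s Cs.
    by case: C0; exists s.
  pose E x := [set sval c x | c in C].
  have E0 x : E x !=set0 by exists (sval c0 x), c0.
  have Elb x : lbound (E x) (- p (- x)).
    move=> _ [[c [sc cp]] Cc <-] /=; have := sublinearN_ge x sc.
    by have := cp (- x); lra.
  have qle x c : C c -> inf (E x) <= sval c x.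
    by move=> Cc; apply: ge_inf; [exists (- p (- x))|exists c].
  have sE : sublinear (fun x => inf (E x)).
    apply: sublinearI => [x y||r x r0].
    + rewrite -lerBlDr; apply: lb_le_inf => // _ [c Cc <-].
      rewrite lerBlDr [leRHS]addrC -lerBlDr; apply: lb_le_inf => // _ [d Cd <-].
      rewrite lerBlDr; have [/leP cd|/leP dc] := Ctot _ _ Cc Cd.
        apply: le_trans (qle _ _ Cd) _.
        apply: le_trans ((svalP d).1.1 _ _) _.
        by have := cd x; lra.
      apply: le_trans (qle _ _ Cc) _.
      apply: le_trans ((svalP c).1.1 _ _) _.
      by have := dc y; lra.
    + by rewrite (le_trans (qle _ _ Cc0))// (sublinear0 (svalP c0).1).
    + rewrite -ler_pdivrMl//; apply: lb_le_inf => // _ [c Cc <-].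
      rewrite ler_pdivrMl//; apply: le_trans (qle _ _ Cc) _.
      by rewrite (svalP c).1.2 ?(ltW r0).
  have Ep x : inf (E x) <= p x.
    by rewrite (le_trans (qle _ _ Cc0))//; exact: (svalP c0).2.
  exists (exist (fun q => sublinear q /\ forall x, q x <= p x) _ (conj sE Ep)).
  by move=> c Cc; apply/leP => x /=; exact: qle.
- exists q; split=> // q' sq' q'q.
  have q'p x : q' x <= p x by exact: le_trans (q'q x) (qp x).
  suff /qmin[] : le (exist _ q (conj sq qp)) (exist _ q' (conj sq' q'p)) by [].
  exact/leP.
Qed.

(** Lower [p] along [S], then pass to a minimal sublinear minorant [q], which is real linear; the
    bound at [- u.1] becomes the constraint at [u.1] because [q] is odd. *)
Lemma mazur_orlicz p S : sublinear p -> convex_cone S ->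
  (forall u, S u -> u.2 <= p u.1) ->
  exists f : {linear V -> R[i]^o},
    (forall x, complex.Re (f x) <= p x) /\
    (forall u, S u -> u.2 <= complex.Re (f u.1)).
Proof.
move=> sp cS Sp.
have [p' [sp' p'p p'S]] := sublinear_below_cone sp cS Sp.
have [q [sq qp' qmin]] := minimal_sublinear sp'.
(* Minimality forces linearity: lowering [q] along the ray of [v] changes nothing. *)
have qN v : q (- v) = - q v.
  pose L := [set u : V * R | exists2 t : R, 0 <= t & u = (t%:C%C *: v, t * q v)].
  have [||q' [sq' q'q q'L]] := @sublinear_below_cone q L sq.
  - split=> [|_ _ [s s0 ->] [t t0 ->]|r _ r0 [t t0 ->]].
    + by exists 0; rewrite // scale0r mul0r.
    + by exists (s + t); rewrite ?addr_ge0//= -scalerDl -rmorphD -mulrDl.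
    + by exists (r * t); rewrite ?mulr_ge0 ?(ltW r0)//= rmorphM scalerA mulrA.
  - by move=> _ [t t0 ->] /=; rewrite sq.2.
  have := q'L (v, q v); rewrite (qmin _ sq' q'q) /=.
  have := sublinearN_ge v sq => h1 h2; apply/eqP; rewrite eq_le h2 /=.
    by lra.
  by exists 1; rewrite // scale1r mul1r.
have qD x y : q (x + y) = q x + q y.
  apply/eqP; rewrite eq_le sq.1 /=.
  by have := sq.1 (x + y) (- y); rewrite addrK qN; lra.
have qZ (r : R) x : q (r%:C%C *: x) = r * q x.
  have [r0|r0] := leP 0 r; first by rewrite sq.2.
  rewrite -[r]opprK rmorphN scaleNr qN mulNr; congr (- _).
  by rewrite sq.2// oppr_ge0 ltW.
(* The complex-linear functional whose real part is the real-linear [q]. *)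
pose g x : R[i]^o := (q x -i* q ('i%C *: x))%C.
have lg : linear g.
  move=> [a b] x y; apply/eqP; rewrite eq_complex /=.
  have e z : (a +i* b)%C *: z = a%:C%C *: z + b%:C%C *: ('i%C *: z).
    rewrite scalerA -scalerDl; congr (_ *: _).
    by apply/eqP; rewrite eq_complex /= !mul0r !mulr0 mulr1 !subr0 !addr0 add0r !eqxx.
  rewrite scalerDr scalerA [_ * (a +i* b)%C]mulrC -scalerA !qD !e !qD !qZ.
  have -> : 'i%C *: ('i%C *: x) = - x by rewrite scalerA -expr2 sqr_i scaleN1r.
  by rewrite qN; apply/andP; split; apply/eqP; ring.
pose f : {linear V -> R[i]^o} :=
  HB.pack g (GRing.isLinear.Build _ _ _ _ _ lg).
exists f; split=> [x|u Su] /=; first exact: le_trans (qp' x) (p'p x).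
have := le_trans (qp' _) (p'S _ Su); rewrite qN; lra.
Qed.

End HahnBanach.

(** * Existence of couplings *)

Section ComplexFunctional.
Variable R : realType.

Lemma Re_mul_inj (z w : R[i]) :
  (forall c : R[i], complex.Re (c * z) <= complex.Re (c * w)) -> z = w.
Proof.
case: z w => a b [c d] zw.
have := zw 1; have := zw (-1); have := zw 'i%C; have := zw (- 'i%C).
by move=> /= h1 h2 h3 h4; congr Complex; lra.
Qed.

Lemma linear_Re_inj (V : lmodType R[i]) (f g : {linear V -> R[i]^o}) :
  (forall x, complex.Re (f x) <= complex.Re (g x)) -> f =1 g.
Proof.
by move=> fg x; apply: Re_mul_inj => c; have := fg (c *: x); rewrite !linearZ.
Qed.

(** Testing the multiples of [x] by ['i%C] and [- 'i%C] kills the imaginary part of [f x]; the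
    multiple by -1 gives the sign. *)
Lemma positive_of_dominated (A : cstarAlgType R) (f : {linear A -> R[i]^o})
    (p : A -> R) : (forall x, complex.Re (f x) <= p x) ->
  (forall (c : R[i]) x, complex.Re c <= 0 -> cpos x -> p (c *: x) <= 0) ->
  positive_functional f.
Proof.
move=> fp p0 x px.
have h (c : R[i]) : complex.Re c <= 0 -> complex.Re (c * f x) <= 0.
  move=> c0; have := le_trans (fp _) (p0 c x c0 px).
  by rewrite linearZ.
have h1 := h 'i%C (lexx 0).
have h2 : complex.Re (- 'i%C * f x) <= 0 by apply: h; rewrite /= oppr0.
have h3 := h (-1) (lerN10 _).
rewrite lecE; move: h1 h2 h3; case: (f x) => u v /= h1 h2 h3.
by apply/andP; split; [apply/eqP|]; lra.
Qed.

End ComplexFunctional.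

(** * Vector functionals and the numerical range of a representation *)

Section VectorFunctional.
Variables (R : realType) (A : cstarAlgType R) (H : hilbertType R).
Variable pi : A -> H -> H.
Hypothesis rpi : representation pi.

Lemma vector_functional (h : H) : exists f : {linear A -> R[i]^o},
  positive_functional f /\ forall a, f a = inner (pi a h) h.
Proof.
have lg : linear (fun a => inner (pi a h) h : R[i]^o).
  by move=> c a b; rewrite (repDl rpi) (repZl rpi) linearPl.
pose f : {linear A -> R[i]^o} := HB.pack (fun a => inner (pi a h) h : R[i]^o)
  (GRing.isLinear.Build _ _ _ _ _ lg).
exists f; split=> // _ [y ->] /=.
by rewrite (inner_rep_sqr rpi) exprn_ge0.
Qed.

Lemma Re_inner_rep_le a h :
  complex.Re (inner (pi a h) h) <= complex.Re `|a| * complex.Re (inner h h).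
Proof.
have [f [fpos fE]] := vector_functional h.
by have := pos_Re_le fpos a; rewrite !fE (rep1 rpi).
Qed.

Lemma exists_unit_vector : injective pi -> (cone : A) != 0 ->
  exists h : H, inner h h = 1.
Proof.
move=> ipi c0; have [h h0] : exists h : H, h != 0.
  apply: contrapT => /forallNP h0.
  move/negP: c0; apply; apply/eqP/ipi/funext => h.
  by rewrite (rep1 rpi) (rep0l rpi); have /negP/negPn/eqP := h0 h.
exists (`|h|^-1 *: h); rewrite -normE_inner normrZ normfV normr_id.
by rewrite mulVf ?expr1n ?normr_eq0.
Qed.

(** The real part of [c%:C%C *: cone - a] has nonnegative quadratic form, so faithfulness makes it
    positive and [phi] is nonnegative on it. *)
Lemma state_le_numerical_range (phi : {linear A -> R[i]^o}) a (c : R) :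
  state phi -> injective pi ->
  (forall h, inner h h = 1 -> complex.Re (inner (pi a h) h) <= c) ->
  complex.Re (phi a) <= c.
Proof.
move=> [phipos phi1] ipi ac.
pose d := c%:C%C *: cone - a.
have dpos h : 0 <= complex.Re (inner (pi d h) h).
  have [->|h0] := eqVneq h 0; first by rewrite linear0r.
  have nh : 0 < complex.Re `|h|.
    by have : 0 < `|h| by [rewrite normr_gt0]; rewrite ltcE => /andP[].
  pose r := (complex.Re `|h|)^-1; pose g := r%:C%C *: h.
  have hg : h = (complex.Re `|h|)%:C%C *: g.
    by rewrite scalerA -rmorphM /= mulfV ?gt_eqF// scale1r.
  have g1 : inner g g = 1.
    rewrite -normE_inner normrZ ger0_norm ?ler0c ?invr_ge0 ?(ltW nh)//.
    by rewrite (normReC h) -rmorphM /= mulVf ?gt_eqF// expr1n.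
  have dg : 0 <= complex.Re (inner (pi d g) g).
    rewrite (repDl rpi) (repNl rpi) (repZl rpi) (rep1 rpi) linearDl linearNl.
    rewrite linearZl_LR /= g1 raddfB /=.
    by have := ac g g1; lra.
  have -> : pi d h = (complex.Re `|h|)%:C%C *: pi d g.
    have := rep_linear rpi d (complex.Re `|h|)%:C%C g 0.
    by rewrite !addr0 (rep0 rpi) addr0 -hg.
  rewrite [X in inner _ X]hg linearZl_LR linearZr_LR /= conj_Creal ?complex_real//.
  case: (inner _ _) dg => u v /= u0.
  by rewrite !mul0r !subr0 !mulr_ge0 ?(ltW nh).
have : 0 <= complex.Re (phi (re_part d)).
  have : cpos (re_part d).
    apply: (cpos_of_rep rpi ipi (re_part_selfadj d)) => h.
    have [f [fpos fE]] := vector_functional h.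
    by rewrite -fE -(pos_Re_part fpos) fE.
  by move=> /phipos; rewrite lecE => /andP[].
rewrite -(pos_Re_part phipos) linearB linearZ /= phi1.
rewrite (_ : c%:C%C *: 1 = c%:C%C); last exact: mulr1.
by case: (phi a) => u v /=; lra.
Qed.

End VectorFunctional.

(** * Couplings on the minimal tensor product *)

Section MinTensor.
Variables (R : realType) (A B AB : cstarAlgType R) (tens : A -> B -> AB).

Section SpatialModel.
Variables (H K L : hilbertType R) (t : H -> K -> L).
Variables (piA : A -> H -> H) (piB : B -> K -> K) (pi : AB -> L -> L).
Hypotheses (rA : representation piA) (rB : representation piB).
Hypotheses (iA : injective piA) (iB : injective piB).
Hypotheses (ht : hilbert_tensor t) (rpi : representation pi).
Hypothesis npi : forall c, `|c| = (opnorm (pi c))%:C%C.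
Hypothesis tpi : forall a b h k, pi (tens a b) (t h k) = t (piA a h) (piB b k).

(** By continuity [pi (c - d)] vanishes on the closure of the span of the [t h k], which is all of
    [L]; since [pi] is isometric, [c - d] is zero. Bilinearity of [tens] is derived from this. *)
Lemma eq_on_elementary_tensors c d :
  (forall h k, pi c (t h k) = pi d (t h k)) -> c = d.
Proof.
move=> cd; pose e := c - d.
have e0 l : pi e l = 0.
  apply: contrapT => /eqP el.
  have [_ _ dt] := ht.
  have oO : open [set x | pi e x != 0].
    apply: (@open_comp _ _ (pi e) [set y | y != 0]) => [x _|].
      exact: rep_continuous.
    rewrite (_ : [set _ | _] = ~` [set 0]); last first.
      by apply/seteqP; split => y /= /eqP.
    exact/closed_openC/accessible_closed_set1/hausdorff_accessible/norm_hausdorff.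
  have [v [/= /eqP ev [n [z [x [xt vE]]]]]] := dt _ (ex_intro _ l el) oO.
  apply: ev; rewrite {}vE.
  pose g : {linear L -> L} :=
    HB.pack (pi e) (GRing.isLinear.Build _ _ _ _ _ (rep_linear rpi e)).
  rewrite -[pi e]/(g : L -> L) linear_sum big1// => i _; rewrite linearZ /=.
  have [h _ [k _ <-]] := xt i.
  by rewrite (repDl rpi) (repNl rpi) cd subrr scaler0.
apply/eqP; rewrite -subr_eq0 -normr_le0 npi.
rewrite (_ : 0 = 0%:C%C)// lecR; apply: opnorm_le => x _.
by rewrite e0 normr0.
Qed.

Lemma tens_linearl b : linear (tens ^~ b).
Proof.
move=> c x y; apply: eq_on_elementary_tensors => h k.
rewrite (repDl rpi) (repZl rpi) !tpi (repDl rA) (repZl rA).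
by have [[/(_ (piB b k)) lt _] _ _] := ht; exact: lt.
Qed.

Lemma tens_linearr a : linear (tens a).
Proof.
move=> c x y; apply: eq_on_elementary_tensors => h k.
rewrite (repDl rpi) (repZl rpi) !tpi (repDl rB) (repZl rB).
by have [[_ /(_ (piA a h)) lt] _ _] := ht; exact: lt.
Qed.

Lemma tens_cone : tens cone cone = cone.
Proof.
by apply: eq_on_elementary_tensors => h k; rewrite tpi !rep1.
Qed.

Variables (phi : {linear A -> R[i]^o}) (psi : {linear B -> R[i]^o}).
Hypotheses (hphi : state phi) (hpsi : state psi).

(** Only product vectors are kept: on them the quadratic form of [tens a cone + tens cone b] splits
    into a term in [h] and a term in [k]. *)
Definition unit_tensors : set L :=
  [set t u.1 u.2 | u in [set u : H * K | inner u.1 u.1 = 1 /\ inner u.2 u.2 = 1]].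

Definition unit_tensor_values (x : AB) : set R :=
  [set complex.Re (inner (pi x l) l) | l in unit_tensors].

Lemma unit_tensors1 l : unit_tensors l -> inner l l = 1.
Proof.
move=> [[h k] /= [h1 k1] <-].
by have [_ -> _] := ht; rewrite h1 k1 mulr1.
Qed.

(** A state takes the value 1 at the unit, so both algebras are nonzero and their faithful
    representations act on nonzero spaces. *)
Lemma unit_tensors_neq0 : unit_tensors !=set0.
Proof.
have c0 (C : cstarAlgType R) (f : {linear C -> R[i]^o}) : f cone = 1 ->
    (cone : C) != 0.
  by move=> f1; apply: contra_eq_neq f1 => ->; rewrite linear0 eq_sym oner_neq0.
have [h h1] := exists_unit_vector rA iA (c0 _ _ hphi.2).
have [k k1] := exists_unit_vector rB iB (c0 _ _ hpsi.2).
by exists (t h k), (h, k).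
Qed.

Lemma unit_tensor_values_sup x : has_sup (unit_tensor_values x).
Proof.
split.
  by have [l Ll] := unit_tensors_neq0; exists (complex.Re (inner (pi x l) l)), l.
exists (complex.Re `|x|) => _ [l /unit_tensors1 l1 <-].
by have := Re_inner_rep_le rpi x l; rewrite l1 mulr1.
Qed.

Lemma unit_tensor_values_sublinear :
  sublinear (fun x => sup (unit_tensor_values x)).
Proof.
have le x l : unit_tensors l ->
    complex.Re (inner (pi x l) l) <= sup (unit_tensor_values x).
  move=> Ll; apply: ub_le_sup; last by exists l.
  by have [] := unit_tensor_values_sup x.
have nz x : unit_tensor_values x !=set0 by have [] := unit_tensor_values_sup x.
apply: sublinearI => [x y||r x r0].
- apply: ge_sup => // _ [l Ll <-].
  rewrite (repDl rpi) linearDl /=.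
  have := le x l Ll; have := le y l Ll.
  by case: (inner _ _) (inner _ _) => a b [c d] /=; lra.
- by apply: ge_sup => // _ [l Ll <-]; rewrite (rep0l rpi) linear0l.
- apply: ge_sup => // _ [l Ll <-].
  rewrite (repZl rpi) linearZl_LR /=.
  have := le x l Ll; case: (inner _ _) => a b /=.
  by rewrite mul0r subr0 ler_pM2l.
Qed.

(** The two terms of the split quadratic form vary independently, so [state_le_numerical_range] can
    be applied twice: it replaces vectors [h] by [phi], and vectors [k] by [psi]. *)
Lemma product_state_le a b :
  complex.Re (phi a) + complex.Re (psi b) <=
    sup (unit_tensor_values (tens a cone + tens cone b)).
Proof.
set M := sup _.
have key h k : inner h h = 1 -> inner k k = 1 ->
    complex.Re (inner (piA a h) h) + complex.Re (inner (piB b k) k) <= M.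
  move=> h1 k1; apply: ub_le_sup.
    by have [] := unit_tensor_values_sup (tens a cone + tens cone b).
  exists (t h k); first by exists (h, k).
  rewrite (repDl rpi) !tpi !(rep1 rA, rep1 rB) linearDl /=.
  have [_ tI _] := ht; rewrite !tI h1 k1 mulr1 mul1r.
  by case: (inner _ _) (inner _ _) => u v [w z].
rewrite -lerBrDr; apply: (state_le_numerical_range rA hphi iA) => h h1.
rewrite lerBrDr addrC -lerBrDr.
apply: (state_le_numerical_range rB hpsi iB) => k k1.
by rewrite lerBrDr addrC; exact: key.
Qed.

(* By Hahn-Banach, [phi a + psi b] extends from the elements
   [tens a cone + tens cone b] below the numerical-range functional. *)
Lemma couplings_spatial_neq0 : couplings tens phi psi !=set0.
Proof.
pose p x := sup (unit_tensor_values x).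
pose S := [set u : AB * R | exists a b, u =
  (tens a cone + tens cone b, complex.Re (phi a) + complex.Re (psi b))].
pose tl : {linear A -> AB} := HB.pack (tens ^~ cone)
  (GRing.isLinear.Build _ _ _ _ _ (tens_linearl cone)).
pose tr : {linear B -> AB} := HB.pack (tens cone)
  (GRing.isLinear.Build _ _ _ _ _ (tens_linearr cone)).
have SE a b : S (tl a + tr b, complex.Re (phi a) + complex.Re (psi b)).
  by exists a, b.
have SI u a b : u = (tl a + tr b, complex.Re (phi a) + complex.Re (psi b)) -> S u.
  by move=> ->.
have [|_ [a [b ->]]|f [fp Sf]] := @mazur_orlicz _ _ p S unit_tensor_values_sublinear.
- split=> [|_ _ [a [b ->]] [a' [b' ->]]|r _ r0 [a [b ->]]].
  + by apply: (SI _ 0 0); rewrite !linear0 /= !addr0.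
  + apply: (SI _ (a + a') (b + b')); rewrite !linearD /= addrACA; congr (_, _).
    by case: (phi a) (phi a') (psi b) (psi b') => ? ? [? ?] [? ?] [? ?] /=; ring.
  + apply: (SI _ (r%:C%C *: a) (r%:C%C *: b)); rewrite !linearZ /= -scalerDr.
    congr (_, _); case: (phi a) (psi b) => ? ? [? ?] /=.
    by rewrite !mul0r !subr0 mulrDr.
- exact: product_state_le.
exists f; split.
- apply: (positive_of_dominated fp) => c _ c0 [y ->].
  apply: ge_sup; first by have [] := unit_tensor_values_sup (c *: (star y ** y)).
  move=> _ [l Ll <-]; rewrite (repZl rpi) linearZl_LR /= (inner_rep_sqr rpi).
  rewrite normReC -rmorphXn /=; case: c c0 => u v /= u0.
  by rewrite mulr0 subr0 mulr_le0_ge0// exprn_ge0// Re_norm_ge0.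
(* The constraints with second component 0 say that [phi] is dominated by [g] in real part; between
   complex-linear functionals this forces equality. *)
- move=> a; pose g : {linear A -> R[i]^o} := f \o tl.
  suff /(_ a) : phi =1 g by [].
  apply: linear_Re_inj => x; have := Sf _ (SE x 0).
  by rewrite !linear0 /= !addr0.
- move=> b; pose g : {linear B -> R[i]^o} := f \o tr.
  suff /(_ b) : psi =1 g by [].
  apply: linear_Re_inj => x; have := Sf _ (SE 0 x).
  by rewrite !linear0 /= !add0r.
Qed.

End SpatialModel.

Lemma min_tensor_cone : min_tensor tens -> tens cone cone = cone.
Proof.
move=> [H [K [L [t [piA [piB [pi [[[rA _] [rB _]] ht [rpi npi] tpi _]]]]]]]].
exact: tens_cone rA rB ht rpi npi tpi.
Qed.

Lemma couplings_neq0 (phi : {linear A -> R[i]^o}) (psi : {linear B -> R[i]^o}) :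
  min_tensor tens -> state phi -> state psi -> couplings tens phi psi !=set0.
Proof.
move=> [H [K [L [t [piA [piB [pi [[[rA iA] [rB iB]] ht [rpi npi] tpi _]]]]]]]].
move=> hphi hpsi.
exact: (couplings_spatial_neq0 rA rB iA iB ht rpi npi tpi hphi hpsi).
Qed.

End MinTensor.

(** * The supremum over couplings *)

Section Convergence.
Variable R : realType.

Lemma le_limn_einf (u v : (\bar R)^nat) : (forall n, u n <= v n)%E ->
  (limn_einf u <= limn_einf v)%E.
Proof.
move=> uv; rewrite !limn_einf_lim; apply: lee_lim; [exact: is_cvg_einfs..|].
apply: nearW => n; apply: le_ereal_inf_tmp => _ [k kn <-].
by apply: le_trans (uv k); apply: ereal_inf_lbound; exists k.
Qed.

Lemma cvg_Re (z_ : nat -> R[i]^o) (z : R[i]^o) : z_ k @[k --> \oo] --> z ->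
  complex.Re (z_ k) @[k --> \oo] --> complex.Re z.
Proof.
move=> zz; apply/cvgrPdist_lt => e e0.
have eC : 0 < e%:C%C :> R[i] by rewrite (_ : 0 = 0%:C%C)// ltcR.
have /cvgrPdist_lt/(_ _ eC) := zz; apply: filterS => k.
rewrite -ltcR; apply: le_lt_trans; apply: le_trans (normc_ge_Re _).
by rewrite lecR; case: z (z_ k) {zz} => a b [c d].
Qed.

End Convergence.

Section Couplings.
Variables (R : realType) (A B AB : cstarAlgType R) (tens : A -> B -> AB).
Variables (phi : {linear A -> R[i]^o}) (psi : {linear B -> R[i]^o}).
Hypotheses (phi1 : phi cone = 1) (tens1 : tens cone cone = cone).
Hypothesis couplings0 : couplings tens phi psi !=set0.

Local Notation C := (couplings tens phi psi).
Local Notation alpha := (coupling_sup tens phi psi).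
Implicit Types (x y S T : AB) (s : {linear AB -> R[i]^o}).

Lemma coupling_cone s : C s -> s cone = 1.
Proof. by case=> _ sphi _; rewrite -tens1 sphi phi1. Qed.

Lemma coupling_Re_le s x : C s -> complex.Re (s x) <= complex.Re `|x|.
Proof.
move=> Cs; have [spos _ _] := Cs.
by have := pos_Re_le spos x; rewrite (coupling_cone Cs) mulr1.
Qed.

Lemma coupling_values_sup x : has_sup (coupling_values tens phi psi x).
Proof.
split; first by have [s Cs] := couplings0; exists (complex.Re (s x)), s.
by exists (complex.Re `|x|) => _ [s Cs <-]; exact: coupling_Re_le.
Qed.

Lemma coupling_sup_ge s x : C s -> complex.Re (s x) <= alpha x.
Proof.
move=> Cs; apply: ub_le_sup; last by exists s.
by have [] := coupling_values_sup x.
Qed.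

Lemma coupling_sup_le x (r : R) :
  (forall s, C s -> complex.Re (s x) <= r) -> alpha x <= r.
Proof.
move=> xr; apply: ge_sup; first by have [] := coupling_values_sup x.
by move=> _ [s Cs <-]; exact: xr.
Qed.

Lemma coupling_sup_sublinear : sublinear alpha.
Proof.
apply: sublinearI => [x y||r x r0].
- apply: coupling_sup_le => s Cs; rewrite linearD.
  have := coupling_sup_ge x Cs; have := coupling_sup_ge y Cs.
  by case: (s x) (s y) => a b [c d] /=; lra.
- by apply: coupling_sup_le => s Cs; rewrite linear0.
- apply: coupling_sup_le => s Cs; rewrite linearZ.
  have := coupling_sup_ge x Cs; case: (s x) => a b /=.
  by rewrite mul0r subr0 ler_pM2l.
Qed.

(** Subadditivity at [u = (u - v) + v] gives one side, and exchanging the arguments the other. *)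
Lemma coupling_sup_dist x y : `|alpha x - alpha y| <= complex.Re `|x - y|.
Proof.
have h u v : alpha u - alpha v <= complex.Re `|u - v|.
  have := coupling_sup_sublinear.1 (u - v) v; rewrite subrK.
  have : alpha (u - v) <= complex.Re `|u - v|.
    by apply: coupling_sup_le => s; exact: coupling_Re_le.
  by lra.
by rewrite ler_norml h andbT lerNl opprB distrC h.
Qed.

Lemma coupling_sup_continuous : continuous alpha.
Proof.
move=> x; apply/cvgrPdist_lt => e e0.
have eC : 0 < e%:C%C :> R[i] by rewrite (_ : 0 = 0%:C%C)// ltcR.
apply: filterS (nbhsx_ballx x _ eC) => y; rewrite -ball_normE /= normReC ltcR.
exact/le_lt_trans/coupling_sup_dist.
Qed.

Lemma coupling_le s S T : C s -> cle S T ->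
  complex.Re (s S) <= complex.Re (s T).
Proof.
move=> [spos _ _] /spos; rewrite linearB lecE => /andP[_].
by case: (s S) (s T) => a b [c d] /=; lra.
Qed.

Lemma coupling_sup_mono S T : cle S T -> alpha S <= alpha T.
Proof.
move=> ST; apply: coupling_sup_le => s Cs.
exact: le_trans (coupling_le Cs ST) (coupling_sup_ge T Cs).
Qed.

Lemma coupling_sup_ge0 T : cpos T -> 0 <= alpha T.
Proof.
move=> Tpos; have [s Cs] := couplings0; apply: le_trans (coupling_sup_ge T Cs).
by have [+ _ _] := Cs => /(_ _ Tpos); rewrite lecE => /andP[].
Qed.

Lemma coupling_sup_convex (t : R) S T : 0 <= t <= 1 ->
  alpha (t%:C%C *: S + (1 - t)%:C%C *: T) <= t * alpha S + (1 - t) * alpha T.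
Proof.
move=> /andP[t0 t1]; have [aD aZ] := coupling_sup_sublinear.
by apply: le_trans (aD _ _) _; rewrite !aZ// subr_ge0.
Qed.

(** * Semicontinuity and monotone convergence along weak* limits *)

Section WeakLimit.
Variables (T_ : nat -> AB) (T : AB).
Hypothesis TT : bidual (T_ k) @[k --> \oo] --> bidual T.

(** Positive functionals are bounded, so [s] lies in the dual and is one of the tests for weak*
    convergence. *)
Lemma coupling_cvg s : C s ->
  complex.Re (s (T_ k)) @[k --> \oo] --> complex.Re (s T).
Proof.
move=> Cs; have [spos _ _] := Cs.
have sdual : (s : AB -> R[i]^o) \in @dual_pred R AB.
  apply/asboolP; split; first exact: linearP.
  exact: pos_continuous.
exact: cvg_Re ((bidual_cvgP _ _).1 TT (Dual sdual)).
Qed.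

(** For each coupling, [s T] is the limit of the [s (T_ k)], which lie below [alpha (T_ k)]; then
    take the supremum over [s]. *)
Lemma coupling_sup_lsc :
  ((alpha T)%:E <= limn_einf (fun k => (alpha (T_ k))%:E))%E.
Proof.
set l := limn_einf _.
have sl s : C s -> ((complex.Re (s T))%:E <= l)%E.
  move=> Cs; have := coupling_cvg Cs => sT.
  have /cvg_limn_einf_sup[<- _] :
      (complex.Re (s (T_ k)))%:E @[k --> \oo] --> (complex.Re (s T))%:E.
    by apply: cvg_EFin => //; exact: nearW.
  by apply: le_limn_einf => n; rewrite lee_fin; exact: coupling_sup_ge.
have [s0 Cs0] := couplings0.
(* The lower limit is an extended real; the existence of a coupling rules out the value minus
   infinity. *)
case: l sl => [r||] sl; [|by rewrite leey|by have := sl _ Cs0].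
by rewrite lee_fin; apply: coupling_sup_le => s /sl; rewrite lee_fin.
Qed.

(** The limit of [alpha (T_ k)] is their supremum, which bounds every [s (T_ k)], hence every [s T];
    conversely [s (T_ n) <= s T], as later terms only increase. *)
Lemma coupling_sup_cvg_nondecreasing :
  (forall m n, (m <= n)%N -> cle (T_ m) (T_ n)) ->
  alpha (T_ k) @[k --> \oo] --> alpha T.
Proof.
move=> Tnd.
have and_ : nondecreasing_seq (fun k => alpha (T_ k)).
  by move=> m n mn; exact/coupling_sup_mono/Tnd.
have aT n : alpha (T_ n) <= alpha T.
  apply: coupling_sup_le => s Cs; apply: le_trans (coupling_sup_ge T Cs).
  apply: (cvgr_to_ge (coupling_cvg Cs)); exists n => // k /= nk.
  exact/(coupling_le Cs)/Tnd.
have ub : has_ubound (range (fun k => alpha (T_ k))).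
  by exists (alpha T) => _ [n _ <-].
have := nondecreasing_cvgn and_ ub.
suff -> : sup (range (fun k => alpha (T_ k))) = alpha T by [].
apply/eqP; rewrite eq_le; apply/andP; split.
  by apply: ge_sup => [|_ [n _ <-]//]; exists (alpha (T_ 0%N)), 0%N.
apply: coupling_sup_le => s Cs.
apply: (cvgr_to_le (coupling_cvg Cs)); apply: nearW => n.
by apply: le_trans (coupling_sup_ge _ Cs) _; apply: ub_le_sup => //; exists n.
Qed.

(* If [L] is the limit of the [alpha (T_ k)], Hahn-Banach below [alpha] gives a
   single coupling [s] with [L <= s (T_ k)] for all [k]. *)
Lemma coupling_sup_cvg_nonincreasing :
  (forall m n, (m <= n)%N -> cle (T_ n) (T_ m)) ->
  alpha (T_ k) @[k --> \oo] --> alpha T.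
Proof.
move=> Tni.
have ani : nonincreasing_seq (fun k => alpha (T_ k)).
  by move=> m n mn; exact/coupling_sup_mono/Tni.
have aT n : alpha T <= alpha (T_ n).
  apply: coupling_sup_le => s Cs; apply: le_trans (coupling_sup_ge (T_ n) Cs).
  apply: (cvgr_to_le (coupling_cvg Cs)); exists n => // k /= nk.
  exact/(coupling_le Cs)/Tni.
have lb : has_lbound (range (fun k => alpha (T_ k))).
  by exists (alpha T) => _ [n _ <-].
have := nonincreasing_cvgn ani lb; set L := inf _.
have LT n : L <= alpha (T_ n) by apply: ge_inf => //; exists n.
suff -> : L = alpha T by [].
apply/eqP; rewrite eq_le; apply/andP; split; last first.
  by apply: lb_le_inf => [|_ [n _ <-]//]; exists (alpha (T_ 0%N)), 0%N.
(* The wanted constraints are the pairs [(T_ k, L)]. Admitting every [u.1] that dominates a multiple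
   of some [T_ k] under all couplings makes them a convex cone. *)
pose D := [set u : AB * R | exists k (t : R), [/\ 0 <= t, u.2 = t * L &
  forall s, C s -> t * complex.Re (s (T_ k)) <= complex.Re (s u.1)]].
have [|u [k [t [t0 -> tu]]]|f [fa Df]] :=
    @mazur_orlicz _ _ alpha D coupling_sup_sublinear.
- split.
  + exists 0%N, 0; split=> //=; first by rewrite mul0r.
    by move=> s _; rewrite linear0 mul0r.
  + move=> [u ?] [v ?] [i [a [a0 /= -> au]]] [j [b [b0 /= -> bv]]].
    (* The sequence decreases, so its term at [maxn i j] lies below both [T_ i] and [T_ j]. *)
    exists (maxn i j), (a + b); split; [exact: addr_ge0|by rewrite mulrDl|].
    move=> s Cs; rewrite linearD /=.
    have := au s Cs; have := bv s Cs.
    have := coupling_le Cs (Tni _ _ (leq_maxl i j)).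
    have := coupling_le Cs (Tni _ _ (leq_maxr i j)).
    by case: (s u) (s v) => ? ? [? ?] /=; nra.
  + move=> r [u ?] r0 [i [a [a0 /= -> au]]]; exists i, (r * a).
    split; [by rewrite mulr_ge0// ltW|by rewrite mulrA|] => s Cs.
    rewrite linearZ /=; have := au s Cs; case: (s u) => c d /=.
    by rewrite mul0r subr0 -mulrA ler_pM2l.
- apply: le_trans (ler_wpM2l t0 (LT k)) _.
  rewrite -coupling_sup_sublinear.2//; apply: coupling_sup_le => s Cs.
  apply: le_trans (coupling_sup_ge u.1 Cs); apply: le_trans (tu s Cs).
  by rewrite linearZ; case: (s (T_ k)) => a b /=; rewrite mul0r subr0.
(* Domination by [alpha] makes [f] a coupling: [alpha] is nonpositive on [c *: x] for [x] positive
   and [complex.Re c <= 0], and on each marginal algebra all couplings agree, so there domination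
   becomes equality. *)
have Cf : C f.
  split.
  - apply: (positive_of_dominated fa) => c x c0 px.
    apply: coupling_sup_le => s [spos _ _].
    rewrite linearZ; have := spos _ px; rewrite lecE.
    case: (s x) c c0 => a b [c d] /= c0 /andP[/eqP -> a0].
    by rewrite mulr0 subr0 mulr_le0_ge0.
  - move=> a; apply: Re_mul_inj => c.
    have := fa (c *: tens a cone); rewrite linearZ => /le_trans; apply.
    by apply: coupling_sup_le => s [_ sphi _]; rewrite linearZ sphi.
  - move=> b; apply: Re_mul_inj => c.
    have := fa (c *: tens cone b); rewrite linearZ => /le_trans; apply.
    by apply: coupling_sup_le => s [_ _ spsi]; rewrite linearZ spsi.
have Lf k : L <= complex.Re (f (T_ k)).
  apply: (Df (T_ k, L)); exists k, 1; split=> //=; first by rewrite mul1r.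
  by move=> s _; rewrite mul1r.
apply: le_trans (coupling_sup_ge T Cf).
apply: (cvgr_to_ge (coupling_cvg Cf)); exact: nearW.
Qed.

End WeakLimit.

End Couplings.

Theorem proposition2p11 (R : realType)
    (A : cstarAlgType R) (phi : {linear A -> R[i]^o}) (hphi : state phi)
    (B : cstarAlgType R) (psi : {linear B -> R[i]^o}) (hpsi : state psi)
    (AB : cstarAlgType R) (tens : A -> B -> AB) (htens : min_tensor tens) :
  let alpha := coupling_sup tens phi psi in
  (* (i) *)
  (forall (T_ : nat -> AB) (T : AB),
     (forall k, cpos (T_ k)) -> cpos T ->
     bidual (T_ k) @[k --> \oo] --> bidual T ->
     ((alpha T)%:E <= limn_einf (fun k => (alpha (T_ k))%:E))%E /\
     ((forall m n, (m <= n)%N -> cle (T_ m) (T_ n)) \/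
      (forall m n, (m <= n)%N -> cle (T_ n) (T_ m)) ->
      alpha (T_ k) @[k --> \oo] --> alpha T)) /\
  (* (ii) *)
  [/\ (* the supremum is over a nonempty bounded set and lies in [0, oo[ *)
      forall T, cpos T -> has_sup (coupling_values tens phi psi T) /\ 0 <= alpha T,
      forall (t : R) (S T : AB), 0 <= t <= 1 -> cpos S -> cpos T ->
        alpha (t%:C%C *: S + (1 - t)%:C%C *: T)
          <= t * alpha S + (1 - t) * alpha T,
      forall S T : AB, cpos S -> cpos T -> cle S T -> alpha S <= alpha T &
      {within [set T : AB | cpos T], continuous alpha}].
Proof.
have tens1 := min_tensor_cone htens.
have couplings0 := couplings_neq0 htens hphi hpsi.
have phi1 := hphi.2.
move=> alpha; split=> [T_ T _ _ TT|].
  split; first exact: (coupling_sup_lsc phi1 tens1 couplings0 TT).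
  case=> mono.
    exact: (coupling_sup_cvg_nondecreasing phi1 tens1 couplings0 TT mono).
  exact: (coupling_sup_cvg_nonincreasing phi1 tens1 couplings0 TT mono).
split=> [T Tpos|t S T t01 _ _|S T _ _|].
- split; first exact: (coupling_values_sup phi1 tens1 couplings0 T).
  exact: (coupling_sup_ge0 phi1 tens1 couplings0 Tpos).
- exact: (coupling_sup_convex phi1 tens1 couplings0 S T t01).
- exact: (coupling_sup_mono phi1 tens1 couplings0).
- apply: continuous_subspaceT.
  exact: (coupling_sup_continuous phi1 tens1 couplings0).
Qed.
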